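(* Let $f$ be a mining graph invariant, let $G$ be a graph, and let $X\subsetneq V(G)$ be a vertex set such that $G-X=H\sqcup H'$ for graphs $H,H'$ with $f(H)<f(H')$. Then $vs_f(G)\leq vs_f(H)+|X|$.
   Context: All graphs are finite and simple (the graph with no vertices is allowed). An invariant is a function $f$ from graphs to $[0,\infty)$ that is constant on isomorphism classes. $H_1\sqcup H_2$ denotes disjoint union. $f$ is mining if $f(H_1\sqcup H_2)=\min\{f(H_1),f(H_2)\}$ for all disjoint graphs $H_1,H_2$. The $f$-vertex stability number is $vs_f(G)=\min\{|X|: X\subseteq V(G),\ f(G-X)\neq f(G)\}$, and $vs_f(G)=\infty$ if $f(G-X)=f(G)$ for all $X\subseteq V(G)$ ($X=V(G)$ is allowed). *)

(* Defs.v *)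
From HB Require Import structures.
From mathcomp Require Import all_boot all_order all_algebra.
From mathcomp Require Import constructive_ereal reals.

Set Implicit Arguments.
Unset Strict Implicit.
Unset Printing Implicit Defensive.

Import Order.TTheory GRing.Theory Num.Theory.
Local Open Scope ring_scope.

Record sgraph := SGraph {
  vertex :> finType;
  adj : rel vertex;
  adj_sym : symmetric adj;
  adj_irrefl : irreflexive adj }.

Definition isomorphic (G H : sgraph) : Prop :=
  exists h : G -> H, bijective h /\ forall x y : G, adj (h x) (h y) = adj x y.

Section Deletion.
Variables (G : sgraph) (X : {set G}).

Definition del_adj : rel {x : G | x \notin X} :=
  fun x y => adj (val x) (val y).

Lemma del_adj_sym : symmetric del_adj.
Proof. by move=> x y; exact: adj_sym. Qed.

Lemma del_adj_irrefl : irreflexive del_adj.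
Proof. by move=> x; exact: adj_irrefl. Qed.

(* The induced subgraph G - X. *)
Definition del : sgraph := SGraph del_adj_sym del_adj_irrefl.
End Deletion.

Section DisjointUnion.
Variables H1 H2 : sgraph.

Definition dunion_adj : rel (H1 + H2)%type := fun u v =>
  match u, v with
  | inl x, inl y => adj x y
  | inr x, inr y => adj x y
  | _, _ => false
  end.

Lemma dunion_adj_sym : symmetric dunion_adj.
Proof. by move=> [x|x] [y|y] //=; exact: adj_sym. Qed.

Lemma dunion_adj_irrefl : irreflexive dunion_adj.
Proof. by move=> [x|x] /=; exact: adj_irrefl. Qed.

Definition dunion : sgraph := SGraph dunion_adj_sym dunion_adj_irrefl.
End DisjointUnion.

Section Invariants.
Variable R : realType.

Definition is_invariant (f : sgraph -> R) : Prop :=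
  (forall G, 0 <= f G) /\ (forall G H, isomorphic G H -> f G = f H).

Definition is_mining (f : sgraph -> R) : Prop :=
  forall H1 H2, f (dunion H1 H2) = Num.min (f H1) (f H2).

(* The minimum over an empty family is +oo, which is the case where deleting
   vertices never changes the value of f. *)
Definition vs (f : sgraph -> R) (G : sgraph) : \bar R :=
  \big[Order.min/+oo%E]_(X : {set G} | f (del X) != f G) (#|X|%:R)%:E.
End Invariants.

(* Main.v *)
(** If [f (G - X) <> f G], then [X] itself witnesses the bound.  Otherwise
    [f G = f (G - X) = f H], since [f] is mining and [f H < f H'].  For
    [Y] with [f (H - Y) <> f H], deleting [X] and the copy of [Y] from [G] leaves
    a graph isomorphic to [(H - Y) + H'], where [f] takes the value
    [min (f (H - Y)) (f H') <> f H]. *)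
Require Import Defs.
From mathcomp Require Import all_boot all_order all_algebra.
From mathcomp Require Import constructive_ereal reals.

Import Order.TTheory GRing.Theory Num.Theory.
Local Open Scope ring_scope.

(** Turns an induced embedding into a vertex deletion: the deleted set is the complement of the
    image. *)
Lemma isomorphic_del_codom (K G : sgraph) (e : K -> G) (e_inj : injective e)
    (e_adj : forall x y : K, adj (e x) (e y) = adj x y) :
  isomorphic K (del (~: [set e x | x : K])).
Proof.
have eP x : e x \notin ~: [set e x | x : K].
  by rewrite in_setC negbK imset_f.
pose h (x : K) : del (~: [set e x | x : K]) := Sub (e x) (eP x).
have h_inj : injective h by move=> x y /(congr1 val) /e_inj.
exists h; split; last by move=> x y; exact: e_adj.
apply: inj_card_bij => //.
rewrite card_sig -(card_imset predT e_inj); apply/eq_leq/eq_card => x.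
by rewrite !inE negbK.
Qed.

(** [Z] is the complement of the copy of [(H - Y) + H'] that the inverse of the given isomorphism
    places in [G], so only its size needs an argument. *)
Lemma isomorphic_del_dunion (G H H' : sgraph) (X : {set G}) (Y : {set H}) :
  isomorphic (del X) (dunion H H') ->
  exists2 Z : {set G}, (#|Z| <= #|Y| + #|X|)%N &
    isomorphic (dunion (del Y) H') (del Z).
Proof.
move=> [h [[g hK gK] h_adj]].
have g_inj : injective g := can_inj gK.
pose i (u : dunion (del Y) H') : dunion H H' :=
  match u with inl y => inl (val y) | inr y => inr y end.
have i_inj : injective i.
  by move=> [x|x] [y|y] //= [] => [/val_inj|] ->.
pose e u := val (g (i u)).
have e_inj : injective e by move=> x y /val_inj /g_inj /i_inj.
have e_adj x y : adj (e x) (e y) = adj x y.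
  have -> : adj (e x) (e y) = adj (g (i x)) (g (i y)) by [].
  by rewrite -h_adj !gK; case: x y => [x|x] [y|y].
exists (~: [set e x | x : dunion (del Y) H']); last exact: isomorphic_del_codom.
pose k (y : H) : G := val (g (inl y)).
(* A vertex outside [X] corresponds to one of [H + H'], and [e] misses it only if that one lies in
   [Y]. *)
have sub : ~: [set e x | x : dunion (del Y) H'] \subset k @: Y :|: X.
  apply/subsetP => x; rewrite !inE orbC; case: (boolP (x \in X)) => //= xX.
  have xE : x = val (g (h (Sub x xX : del X))) by rewrite hK.
  case hx: (h _) xE => [y|y] ->; last by rewrite (imset_f e (x := inr y)).
  case: (boolP (y \in Y)) => [yY _|yY]; first exact: (imset_f k).
  by rewrite (imset_f e (x := inl (Sub y yY : del Y))).
apply: leq_trans (subset_leq_card sub) _.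
apply: leq_trans (leq_card_setU _ _) _.
by rewrite leq_add2r leq_imset_card.
Qed.

Lemma vs_le (R : realType) (f : sgraph -> R) (G : sgraph) (X : {set G}) :
  f (del X) != f G -> (vs f G <= (#|X|%:R)%:E)%E.
Proof. by move=> fX; rewrite /vs; apply: bigmin_le_cond. Qed.

Lemma vs_ge0 (R : realType) (f : sgraph -> R) (G : sgraph) :
  (0 <= vs f G)%E.
Proof.
by apply: le_bigmin => [|X _]; [exact: leey | rewrite lee_fin ler0n].
Qed.

Theorem theorem2p3 (R : realType) (f : sgraph -> R)
    (f_inv : is_invariant f) (f_mining : is_mining f)
    (G : sgraph) (X : {set G}) (H H' : sgraph) :
  X \proper [set: G] ->
  isomorphic (del X) (dunion H H') ->
  f H < f H' ->
  (vs f G <= vs f H + (#|X|%:R)%:E)%E.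
Proof.
move=> _ isoX ltf; have [_ f_iso] := f_inv.
have fX : f (del X) = f H by rewrite (f_iso _ _ isoX) f_mining min_l // ltW.
have [fG|] := eqVneq (f (del X)) (f G); last first.
  by move=> /vs_le /le_trans; apply; rewrite leeDr // vs_ge0.
(* Only [vs f H] is unfolded. The bound holds at [+oo] and passes to minima, which leaves a single
   [Y] with [f (H - Y) <> f H]. *)
rewrite {2}/vs; elim/big_ind: _ => [|u v hu hv|Y fY].
- by rewrite addye // leey.
- by rewrite minEle; case: ifP.
have [Z cardZ isoZ] := isomorphic_del_dunion G H H' X Y isoX.
apply: (@le_trans _ _ (#|Z|%:R)%:E); last first.
  by rewrite -EFinD lee_fin -natrD ler_nat.
apply: vs_le; rewrite -(f_iso _ _ isoZ) f_mining -fG fX minEle.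
(* The minimum is [f (H - Y)], excluded by [fY], or [f H'], which exceeds [f H]. *)
by case: ifP => // _; rewrite gt_eqF.
Qed.
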